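(* Let $\triangle$ be a simplicial complex on $V=[n]=\{1,\dots,n\}$, let $\{D(x_i)\mid 1\le i\le n\}$ be the covering of $\operatorname{Spec}^\bullet M_\triangle$ given by the generators $x_1,\dots,x_n$ of the simplicial binoid $M_\triangle$, and let $G$ be the constant sheaf on $\operatorname{Spec}^\bullet M_\triangle$ associated to an abelian group $G$. Then Čech cohomology and simplicial cohomology are described by the same cochain complexes, $$\mathcal C^\bullet(\triangle,G)=\check{\mathcal C}^\bullet(\{D(x_i)\},G).$$ In particular, $\mathrm H^i(\triangle,G)=\check{\mathrm H}^i(\{D(x_i)\},G)$ for all $i\ge 0$.
   Context: A binoid $(M,+,0,\infty)$ is a commutative monoid with an absorbing element $\infty$. An ideal is a subset $I\ni\infty$ with $M+I\subseteq I$; it is prime if $I\ne M$ and $a+b\in I$ implies $a\in I$ or $b\in I$. $\operatorname{Spec}M$ is the set of prime ideals with the topology having basis $D(f)=\{\mathfrak p\mid f\notin\mathfrak p\}$, $f\in M$. $M_+=M\setminus M^*$ (with $M^*$ the units) is the unique maximal ideal and $\operatorname{Spec}^\bullet M=\operatorname{Spec}M\setminus\{M_+\}$. A simplicial complex $\triangle$ on a finite set $V$ is a set of subsets of $V$ closed under taking subsets and containing all singletons. $M_\triangle$ is the commutative binoid generated by $x_v$ ($v\in V$) with relations $\sum_{v\in H}x_v=\infty$ for all $H\subseteq V$, $H\notin\triangle$. $\mathcal C^\bullet(\triangle,G)$ is the usual (non-reduced) simplicial cochain complex of $\triangle$ with coefficients in $G$, in degrees $j\ge0$, formed with the ordering of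 $V=[n]$; so $\mathcal C^j(\triangle,G)=G^{\triangle_j}$ with $\triangle_j$ the set of faces with $j+1$ elements. $\mathrm H^i(\triangle,G)$ is its cohomology. For a sheaf $\mathscr F$ and a finite open cover $\{U_i\}_{i\in[n]}$, the Čech complex has $\check{\mathcal C}^p=\bigoplus_{i_0<\dots<i_p}\mathscr F(U_{i_0}\cap\dots\cap U_{i_p})$ with the alternating-sum differential, and $\check{\mathrm H}^p$ denotes its cohomology. Equality of complexes means identification via canonical isomorphisms in each degree compatible with the differentials. *)

(* Defs.v *)
From HB Require Import structures.
From mathcomp Require Import all_boot all_algebra all_classical topology zify.

Set Implicit Arguments.
Unset Strict Implicit.
Unset Printing Implicit Defensive.

Import GRing.Theory.
Local Open Scope quotient_scope.
Local Open Scope classical_set_scope.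
Local Open Scope ring_scope.

HB.mixin Record isBinoid M & GRing.Nmodule M := {
  infty : M;
  addinfty : forall a : M, a + infty = infty
}.

#[short(type="binoidType")]
HB.structure Definition Binoid := {M of isBinoid M & GRing.Nmodule M}.

(** The binoid congruence generated by a relation [r]. *)
Inductive congruence (M : binoidType) (r : M -> M -> Prop) : M -> M -> Prop :=
| cong_rel a b : r a b -> congruence r a b
| cong_refl a : congruence r a a
| cong_sym a b : congruence r a b -> congruence r b a
| cong_trans a b c : congruence r a b -> congruence r b c -> congruence r a c
| cong_add a b c : congruence r a b -> congruence r (a + c) (b + c).

Section BinoidQuotient.
Variables (M : binoidType) (r : M -> M -> Prop).

Definition congruenceb (a b : M) : bool := `[< congruence r a b >].

Lemma congruenceb_equiv : equiv_class_of congruenceb.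
Proof.
split=> [a|a b|b a c].
- by apply/asboolP; exact: cong_refl.
- by apply/asboolP/asboolP; exact: cong_sym.
- by move=> /asboolP ab /asboolP bc; apply/asboolP; exact: cong_trans ab bc.
Qed.

Canonical congruenceb_equiv_rel := EquivRelPack congruenceb_equiv.
Canonical congruenceb_encModRel := defaultEncModRel congruenceb.

Definition quotient_binoid := {eq_quot congruenceb}.

HB.instance Definition _ : EqQuotient M congruenceb quotient_binoid :=
  EqQuotient.on quotient_binoid.
HB.instance Definition _ := Choice.on quotient_binoid.

Lemma quotient_binoidP (a b : M) :
  \pi_quotient_binoid a = \pi_quotient_binoid b <-> congruence r a b.
Proof.
by split=> [/eqP|ab]; [|apply/eqP]; rewrite piE; [move/asboolP|apply/asboolP].
Qed.

Lemma congruenceD (a a' b b' : M) :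
  congruence r a a' -> congruence r b b' -> congruence r (a + b) (a' + b').
Proof.
move=> aa' bb'; apply: cong_trans (cong_add b aa') _.
by rewrite ![a' + _]addrC; exact: cong_add.
Qed.

Definition quotient_binoid_add (x y : quotient_binoid) : quotient_binoid :=
  \pi_quotient_binoid (repr x + repr y)%R.

Lemma quotient_binoid_addE (a b : M) :
  quotient_binoid_add (\pi a) (\pi b) = \pi_quotient_binoid (a + b).
Proof.
by apply/quotient_binoidP/congruenceD; apply/quotient_binoidP; rewrite reprK.
Qed.

Lemma quotient_binoid_addA : associative quotient_binoid_add.
Proof.
move=> x y z; rewrite -[x]reprK -[y]reprK -[z]reprK.
by rewrite !quotient_binoid_addE addrA.
Qed.

Lemma quotient_binoid_addC : commutative quotient_binoid_add.
Proof. by move=> x y; rewrite /quotient_binoid_add addrC. Qed.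

Lemma quotient_binoid_add0 : left_id (\pi_quotient_binoid 0) quotient_binoid_add.
Proof. by move=> x; rewrite -[x]reprK quotient_binoid_addE add0r. Qed.

HB.instance Definition _ := GRing.isNmodule.Build quotient_binoid
  quotient_binoid_addA quotient_binoid_addC quotient_binoid_add0.

Lemma quotient_binoid_addinfty (x : quotient_binoid) :
  x + \pi_quotient_binoid infty = \pi_quotient_binoid infty.
Proof. by rewrite -[x]reprK [LHS]quotient_binoid_addE addinfty. Qed.

HB.instance Definition _ :=
  isBinoid.Build quotient_binoid quotient_binoid_addinfty.

End BinoidQuotient.

(** The free commutative binoid on [V]: a finite multiset of elements of [V],
    given by its multiplicities, or [None] for the absorbing element. *)
Section FreeBinoid.
Variable V : finType.

Definition free_binoid : Type := option {ffun V -> nat}.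

HB.instance Definition _ := Choice.on free_binoid.

Definition free_binoid_add (a b : free_binoid) : free_binoid :=
  match a, b with
  | Some f, Some g => Some (f + g)
  | _, _ => None
  end.

Lemma free_binoid_addA : associative free_binoid_add.
Proof. by case=> [f|] [g|] [h|] //=; rewrite addrA. Qed.

Lemma free_binoid_addC : commutative free_binoid_add.
Proof. by case=> [f|] [g|] //=; rewrite addrC. Qed.

Lemma free_binoid_add0 : left_id (Some 0) free_binoid_add.
Proof. by case=> [f|] //=; rewrite add0r. Qed.

HB.instance Definition _ := GRing.isNmodule.Build free_binoid
  free_binoid_addA free_binoid_addC free_binoid_add0.

Lemma free_binoid_addinfty (a : free_binoid) : a + None = None.
Proof. by case: a. Qed.

HB.instance Definition _ := isBinoid.Build free_binoid free_binoid_addinfty.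

Definition free_gen (v : V) : free_binoid := Some [ffun w => (w == v) : nat].

End FreeBinoid.

Section Spectrum.
Variable M : binoidType.

Definition ideal (I : set M) : Prop :=
  I infty /\ forall a b : M, I b -> I (a + b).

Definition prime_ideal (I : set M) : Prop :=
  [/\ ideal I, I <> setT & forall a b : M, I (a + b) -> I a \/ I b].

Definition units : set M := [set a | exists b, a + b = 0].

Definition nonunits : set M := ~` units.

Record spec := Spec {
  prime_set :> set M;
  prime_setP : prime_ideal prime_set
}.

HB.instance Definition _ := gen_eqMixin spec.
HB.instance Definition _ := gen_choiceMixin spec.

Definition basic_open (f : M) : set spec := [set p | ~ (p : set M) f].

Definition spec_open (U : set spec) : Prop :=
  exists F : set M, U = \bigcup_(f in F) basic_open f.

Lemma prime_ideal_add (p : spec) (a b : M) : ~ (p : set M) a ->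
  ~ (p : set M) b -> ~ (p : set M) (a + b).
Proof. by move=> pa pb; case: (prime_setP p) => _ _ pD /pD []. Qed.

Lemma prime_ideal_sub (p : spec) (a b : M) : ~ (p : set M) (a + b) ->
  ~ (p : set M) a /\ ~ (p : set M) b.
Proof.
case: (prime_setP p) => -[_ pI] _ _ pab.
split=> pc; apply: pab; last exact: pI.
by rewrite addrC; exact: pI.
Qed.

Lemma prime_ideal0 (p : spec) : ~ (p : set M) 0.
Proof.
case: (prime_setP p) => -[_ pI] pT _ p0; apply: pT.
by apply/seteqP; split=> // a _; rewrite -[a]addr0; exact: pI.
Qed.

Lemma spec_openT : spec_open setT.
Proof.
exists setT; apply/seteqP; split=> // p _; exists 0 => //.
exact: prime_ideal0.
Qed.

Lemma spec_openI : setI_closed spec_open.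
Proof.
move=> _ _ [F ->] [G ->].
exists [set c | exists f g, [/\ F f, G g & c = f + g]].
apply/seteqP; split=> [p [[f Ff pf] [g Gg pg]]|p [_ [f [g [Ff Gg ->]]]]].
  by exists (f + g); [exists f, g|exact: prime_ideal_add].
by move=> /prime_ideal_sub[pf pg]; split; [exists f|exists g].
Qed.

Lemma spec_open_bigU (I : Type) (U : I -> set spec) :
  (forall i, spec_open (U i)) -> spec_open (\bigcup_i U i).
Proof.
move=> /choice[F UF]; exists (\bigcup_i F i).
apply/seteqP; split=> [p [i _]|p [f [i _ Ff] pf]].
  by rewrite UF => -[f Ff pf]; exists f => //; exists i.
by exists i => //; rewrite UF; exists f.
Qed.

HB.instance Definition _ := isOpenTopological.Build spec
  spec_openT spec_openI spec_open_bigU.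

Definition punctured : set spec := [set p | (p : set M) <> nonunits].

(** A set coerces to its type of points, with the subspace topology. *)
Definition punctured_spec : topologicalType := (punctured : Type).

End Spectrum.

Record opens (X : topologicalType) := Opens {
  open_set :> set X;
  open_setP : open open_set
}.

Definition opensI (X : topologicalType) (U V : opens X) : opens X :=
  Opens (openI (open_setP U) (open_setP V)).

Record presheaf (X : topologicalType) := Presheaf {
  sections :> opens X -> zmodType;
  restr : forall U V : opens X,
    V `<=` U -> {additive sections U -> sections V};
  restr_id : forall (U : opens X) (UU : U `<=` U) s, restr UU s = s;
  restr_comp : forall (U V W : opens X) (VU : V `<=` U) (WV : W `<=` V)
    (WU : W `<=` U) s, restr WV (restr VU s) = restr WU s
}.

Record sheaf (X : topologicalType) := Sheaf {
  presheaf_of_sheaf :> presheaf X;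
  sheaf_separated : forall (U : opens X) (I : Type) (W : I -> opens X)
    (WU : forall i, W i `<=` U), U `<=` \bigcup_i W i ->
    forall s t : presheaf_of_sheaf U,
      (forall i, restr _ (WU i) s = restr _ (WU i) t) -> s = t;
  sheaf_glue : forall (U : opens X) (I : Type) (W : I -> opens X)
    (WU : forall i, W i `<=` U), U `<=` \bigcup_i W i ->
    forall s : (forall i, presheaf_of_sheaf (W i)),
      (forall i j,
        restr presheaf_of_sheaf (@subIsetl _ (W i) (W j) :
          opensI (W i) (W j) `<=` W i) (s i) =
        restr presheaf_of_sheaf (@subIsetr _ (W i) (W j) :
          opensI (W i) (W j) `<=` W j) (s j)) ->
      exists t : presheaf_of_sheaf U, forall i, restr _ (WU i) t = s i
}.

(** The constant sheaf associated to [G], i.e. the sheafification of the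
    constant presheaf: its sections over [U] are the locally constant functions
    from [U] to [G]. *)
Section ConstantSheaf.
Variables (X : topologicalType) (G : zmodType).

Definition locally_constant (Y : topologicalType) (f : Y -> G) : Prop :=
  forall x, \forall y \near x, f y = f x.

Definition locally_constantb (Y : topologicalType) : {pred Y -> G} :=
  fun f => `[< locally_constant f >].

Lemma locally_constant_zmod_closed (Y : topologicalType) :
  zmod_closed (@locally_constantb Y).
Proof.
split=> [|f g /asboolP cf /asboolP cg]; apply/asboolP => x.
  exact: nearW.
have := cg x; have := cf x; apply: filterS2 => y fy gy.
by rewrite -[LHS]/(f y - g y) fy gy.
Qed.

HB.instance Definition _ (Y : topologicalType) := GRing.isZmodClosed.Build
  (Y -> G) (@locally_constantb Y) (@locally_constant_zmod_closed Y).

Record constant_section (U : opens X) := ConstantSection {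
  section_fun :> U -> G;
  section_funP : section_fun \in @locally_constantb (U : Type)
}.

HB.instance Definition _ (U : opens X) :=
  [isSub of constant_section U for @section_fun U].
HB.instance Definition _ (U : opens X) :=
  [Choice of constant_section U by <:].
HB.instance Definition _ (U : opens X) :=
  [SubChoice_isSubZmodule of constant_section U by <:].

Lemma constant_sectionP (U : opens X) (s t : constant_section U) :
  (forall x, s x = t x) -> s = t.
Proof. by move=> st; apply/val_inj/funext. Qed.

Section Restriction.
Variables (U V : opens X) (VU : V `<=` U).

Definition incl_point (x : V) : U := exist _ (val x) (mem_set (VU (set_valP x))).

Lemma incl_point_continuous : continuous incl_point.
Proof.
apply/continuousP => _ [B oB <-]; exists B => //.
Qed.

Lemma constant_restr_subproof (s : constant_section U) :
  (s \o incl_point) \in @locally_constantb (V : Type).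
Proof.
have /asboolP cf := section_funP s; apply/asboolP => x /=.
exact: incl_point_continuous (cf (incl_point x)).
Qed.

Definition constant_restr (s : constant_section U) : constant_section V :=
  ConstantSection (constant_restr_subproof s).

Lemma constant_restr_is_zmod_morphism : zmod_morphism constant_restr.
Proof. by move=> s t; exact: constant_sectionP. Qed.

HB.instance Definition _ := GRing.isZmodMorphism.Build _ _ constant_restr
  constant_restr_is_zmod_morphism.

End Restriction.

Lemma constant_restr_id (U : opens X) (UU : U `<=` U) (s : constant_section U) :
  constant_restr UU s = s.
Proof.
by apply: constant_sectionP => x /=; congr (s _); exact: val_inj.
Qed.

Lemma constant_restr_comp (U V W : opens X) (VU : V `<=` U) (WV : W `<=` V)
    (WU : W `<=` U) (s : constant_section U) :
  constant_restr WV (constant_restr VU s) = constant_restr WU s.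
Proof.
by apply: constant_sectionP => x /=; congr (s _); exact: val_inj.
Qed.

Definition constant_presheaf : presheaf X := @Presheaf X
  (fun U => constant_section U : zmodType)
  (fun U V VU => constant_restr VU : {additive _ -> _})
  constant_restr_id constant_restr_comp.

Lemma constant_presheaf_separated (U : opens X) (I : Type) (W : I -> opens X)
    (WU : forall i, W i `<=` U) : U `<=` \bigcup_i W i ->
  forall s t : constant_presheaf U,
    (forall i, restr _ (WU i) s = restr _ (WU i) t) -> s = t.
Proof.
move=> UW s t st; apply: constant_sectionP => x.
have [i _ Wx] := UW _ (set_valP x).
pose y : W i := exist _ (val x) (mem_set Wx).
have -> : x = incl_point (WU i) y by exact: val_inj.
exact: (congr1 (fun r : constant_section _ => r y) (st i)).
Qed.

Lemma constant_presheaf_glue (U : opens X) (I : Type) (W : I -> opens X)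
    (WU : forall i, W i `<=` U) : U `<=` \bigcup_i W i ->
  forall s : (forall i, constant_presheaf (W i)),
    (forall i j,
      restr constant_presheaf (@subIsetl _ (W i) (W j) :
        opensI (W i) (W j) `<=` W i) (s i) =
      restr constant_presheaf (@subIsetr _ (W i) (W j) :
        opensI (W i) (W j) `<=` W j) (s j)) ->
    exists t : constant_presheaf U, forall i, restr _ (WU i) t = s i.
Proof.
move=> UW s ss.
have sE i j x (ix : x \in (W i : set X)) (jx : x \in (W j : set X)) :
    (s i : constant_section _) (exist _ x ix) =
    (s j : constant_section _) (exist _ x jx).
  have ijx : x \in (opensI (W i) (W j) : set X).
    by apply/mem_set; split; exact: set_mem.
  have := congr1 (fun r : constant_section _ => r (exist _ x ijx)) (ss i j).
  by rewrite /=; congr (_ = _); congr (section_fun _ _); exact: val_inj.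
have /choice[k kP] : forall x : U, exists i, val x \in (W i : set X).
  move=> x; have [i _ Wx] := UW _ (set_valP x).
  by exists i; exact: mem_set.
pose f (x : U) : G := (s (k x) : constant_section _) (exist _ (val x) (kP x)).
have fE i (x : U) (ix : val x \in (W i : set X)) :
    f x = (s i : constant_section _) (exist _ (val x) ix) by exact: sE.
have fc : f \in @locally_constantb (U : Type).
  apply/asboolP => x; set i := k x.
  have /asboolP/(_ (exist _ (val x) (kP x))) := section_funP (s i).
  move=> [_ [[B oB <-]] Bx sB].
  exists (set_val @^-1` (B `&` W i)); split.
  - by exists (B `&` W i) => //; apply: openI => //; exact: open_setP.
  - by split=> //; exact: set_mem (kP x).
  - move=> y [By /mem_set Wy]; rewrite /= (fE i _ Wy).
    exact: (sB (exist _ (val y) Wy)).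
exists (ConstantSection fc) => i; apply: constant_sectionP => x /=.
by rewrite (fE i (incl_point (WU i) x) (valP x)); congr (section_fun _ _);
  exact: val_inj.
Qed.

Definition constant_sheaf : sheaf X :=
  Sheaf constant_presheaf_separated constant_presheaf_glue.

Lemma const_section_subproof (U : opens X) (g : G) :
  (fun=> g) \in @locally_constantb (U : Type).
Proof. by apply/asboolP => x; exact: filterE. Qed.

Definition const_section (U : opens X) (g : G) : constant_sheaf U :=
  ConstantSection (const_section_subproof U g).

End ConstantSheaf.

Record cochain_complex := CochainComplex {
  cochains :> nat -> zmodType;
  coboundary : forall j, {additive cochains j -> cochains j.+1};
  coboundaryK : forall j (c : cochains j),
    coboundary j.+1 (coboundary j c) = 0
}.
Arguments coboundary {_} j.

Section Cohomology.
Variables (C : cochain_complex) (j : nat).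

Definition is_cocycle : {pred C j} := fun c => coboundary j c == 0.

Lemma is_cocycle_zmod_closed : zmod_closed is_cocycle.
Proof.
split=> [|a b]; rewrite !unfold_in ?raddf0 // raddfB.
by move=> /eqP-> /eqP->; rewrite subr0.
Qed.

HB.instance Definition _ :=
  GRing.isZmodClosed.Build (C j) is_cocycle is_cocycle_zmod_closed.

Record cocycle := Cocycle {
  cocycle_val : C j;
  cocycleP : cocycle_val \in is_cocycle
}.

HB.instance Definition _ := [isSub of cocycle for cocycle_val].
HB.instance Definition _ := [Choice of cocycle by <:].
HB.instance Definition _ := [SubChoice_isSubZmodule of cocycle by <:].

End Cohomology.

(** The image of the incoming coboundary, which is [0] in degree [0]. *)
Definition in_image (C : cochain_complex) (j : nat) : C j -> Prop :=
  match j with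
  | 0 => fun c => c = 0
  | i.+1 => fun c => exists b : C i, coboundary i b = c
  end.

Definition is_coboundary (C : cochain_complex) (j : nat) :
  {pred cocycle C j} := fun z => `[< in_image (cocycle_val z) >].

Lemma is_coboundary_zmod_closed (C : cochain_complex) (j : nat) :
  zmod_closed (@is_coboundary C j).
Proof.
split=> [|a b /asboolP Ba /asboolP Bb]; apply/asboolP; rewrite /=.
  by case: j => //= i; exists 0; rewrite raddf0.
case: j a b Ba Bb => /= [a b -> ->|i a b [a' aE] [b' bE]]; first exact: subr0.
by exists (a' - b'); rewrite raddfB aE bE.
Qed.

HB.instance Definition _ (C : cochain_complex) (j : nat) :=
  GRing.isZmodClosed.Build (cocycle C j) (@is_coboundary C j)
    (@is_coboundary_zmod_closed C j).

Definition cohomology (C : cochain_complex) (j : nat) : zmodType :=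
  Quotient.quot (@is_coboundary C j).

Definition cohomology_class (C : cochain_complex) (j : nat)
  (z : cocycle C j) : cohomology C j :=
  \pi_(Quotient.quot (@is_coboundary C j)) z.

Lemma cohomology_class_is_zmod_morphism (C : cochain_complex) (j : nat) :
  zmod_morphism (@cohomology_class C j).
Proof. exact: raddfB. Qed.

HB.instance Definition _ (C : cochain_complex) (j : nat) :=
  GRing.isZmodMorphism.Build _ _ (@cohomology_class C j)
    (@cohomology_class_is_zmod_morphism C j).

Lemma cohomology_class_repr (C : cochain_complex) (j : nat)
  (h : Quotient.quot (@is_coboundary C j)) : cohomology_class (repr h) = h.
Proof. exact: reprK. Qed.

Lemma cohomology_classP (C : cochain_complex) (j : nat) (y z : cocycle C j) :
  cohomology_class y = cohomology_class z <->
  in_image (cocycle_val (y - z)).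
Proof.
split=> [/eqP|yz]; first by rewrite -Quotient.idealrBE => /asboolP.
by apply/eqP; rewrite -Quotient.idealrBE; apply/asboolP.
Qed.

Record cochain_map (C D : cochain_complex) := CochainMap {
  cochain_map_at :> forall j, {additive C j -> D j};
  cochain_mapE : forall j (c : C j),
    cochain_map_at j.+1 (coboundary j c) = coboundary j (cochain_map_at j c)
}.

Lemma in_image_map (C D : cochain_complex) (phi : cochain_map C D) (j : nat)
    (c : C j) : in_image c -> in_image (phi j c).
Proof.
case: j c => /= [c ->|i c [b <-]]; first by rewrite raddf0.
by exists (phi i b); rewrite cochain_mapE.
Qed.

Section CohomologyMap.
Variables (C D : cochain_complex) (phi : cochain_map C D) (j : nat).

Lemma cocycle_map_subproof (z : cocycle C j) : phi j (cocycle_val z) \in @is_cocycle D j.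
Proof.
by rewrite unfold_in -cochain_mapE (eqP (cocycleP z)) raddf0.
Qed.

Definition cocycle_map (z : cocycle C j) : cocycle D j :=
  Cocycle (cocycle_map_subproof z).

Lemma cocycle_map_is_zmod_morphism : zmod_morphism cocycle_map.
Proof. by move=> a b; apply: val_inj; rewrite /= raddfB. Qed.

HB.instance Definition _ := GRing.isZmodMorphism.Build _ _ cocycle_map
  cocycle_map_is_zmod_morphism.

Definition cohomology_map (h : cohomology C j) : cohomology D j :=
  cohomology_class
    (cocycle_map (repr (h : Quotient.quot (@is_coboundary C j)))).

Lemma cohomology_mapE (z : cocycle C j) :
  cohomology_map (cohomology_class z) = cohomology_class (cocycle_map z).
Proof.
apply/cohomology_classP; rewrite -raddfB /=; apply: in_image_map.
by apply/cohomology_classP; exact: cohomology_class_repr.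
Qed.

Lemma cohomology_map_is_zmod_morphism : zmod_morphism cohomology_map.
Proof.
move=> x y; rewrite -[x]cohomology_class_repr -[y]cohomology_class_repr.
by rewrite -raddfB !cohomology_mapE !raddfB.
Qed.

HB.instance Definition _ := GRing.isZmodMorphism.Build _ _ cohomology_map
  cohomology_map_is_zmod_morphism.

End CohomologyMap.
Arguments cohomology_map [C D] phi j h.

Lemma alternating_sum0 (A : zmodType) (m : nat) (f : 'I_m.+2 -> 'I_m.+1 -> A) :
  (forall (k l : 'I_m.+1), (k <= l)%N ->
    f (lift ord0 l) k = f (widen_ord (leqnSn _) k) l) ->
  \sum_(k < m.+2) (\sum_(l < m.+1) f k l *~ (-1) ^+ l) *~ (-1) ^+ k = 0.
Proof.
move=> fE.
pose F (p : 'I_m.+2 * 'I_m.+1) := f p.1 p.2 *~ ((-1) ^+ p.1 * (-1) ^+ p.2).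
transitivity (\sum_p F p).
  rewrite (eq_bigr (fun k : 'I_m.+2 => \sum_(l < m.+1) F (k, l))).
    by rewrite pair_bigA; apply: eq_bigr => -[].
  move=> k _; rewrite mulrz_suml; apply: eq_bigr => l _.
  by rewrite /F /= mulrC mulrzA.
rewrite (bigID (fun p : 'I_m.+2 * 'I_m.+1 => (p.1 <= p.2)%N)) /=.
pose h (p : 'I_m.+2 * 'I_m.+1) : 'I_m.+2 * 'I_m.+1 :=
  (lift ord0 p.2, inord p.1).
pose g (p : 'I_m.+2 * 'I_m.+1) : 'I_m.+2 * 'I_m.+1 :=
  (widen_ord (leqnSn _) p.2, inord p.1.-1).
rewrite [X in _ + X](reindex_onto h g) /=; last first.
  move=> [k l] /=; rewrite -ltnNge => lk; congr (_, _); apply: val_inj => /=.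
    have k1 : (k.-1 < m.+1)%N by case: k lk => [[|k] kP].
    by rewrite /bump /= inordK // add1n prednK // (leq_ltn_trans _ lk).
  by rewrite inord_val.
rewrite [X in _ + X](eq_bigl (fun p : 'I_m.+2 * 'I_m.+1 => (p.1 <= p.2)%N)); last first.
  move=> [k l] /=; rewrite /bump /= add1n.
  case: (leqP k l) => kl.
    have km : (k < m.+1)%N := leq_ltn_trans kl (ltn_ord l).
    rewrite inordK // -leqNgt kl /=; apply/eqP; congr (_, _).
      by apply: val_inj; rewrite /= inordK.
    by rewrite inord_val.
  apply/negbTE/negP => /andP[+ /eqP[/(congr1 val)/= ik _]].
  by rewrite ik kl.
rewrite -big_split /= big1 // => -[k l] /= kl.
have km : (k < m.+1)%N := leq_ltn_trans kl (ltn_ord l).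
rewrite /F /=; have -> : f k l = f (lift ord0 l) (inord k).
  by rewrite fE ?inordK //; congr f; apply: val_inj; rewrite /= inordK.
rewrite /bump /= add1n inordK // exprS mulN1r mulNr mulrNz mulrC.
exact: subrr.
Qed.

Section Simplex.
Variable n : nat.

(** An index [i_0 < ... < i_p] in [[n]]. *)
Record simplex (p : nat) := Simplex {
  simplex_fun :> 'I_p.+1 -> 'I_n;
  simplexP : forall k l : 'I_p.+1, (k < l)%N ->
    (simplex_fun k < simplex_fun l)%N
}.

Lemma eq_simplex (p : nat) (s t : simplex p) : s =1 t -> s = t.
Proof.
case: s t => [s sP] [t tP] /= /funext st; subst t.
by congr Simplex; exact: Prop_irrelevance.
Qed.

Lemma simplex_face_subproof (p : nat) (s : simplex p.+1) (a : 'I_p.+2)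
  (k l : 'I_p.+1) : (k < l)%N -> (s (lift a k) < s (lift a l))%N.
Proof.
move=> kl; apply: simplexP; rewrite /= /bump.
by case: (leqP a k) => ak; case: (leqP a l) => al; lia.
Qed.

(** The simplex with [i_a] omitted. *)
Definition simplex_face (p : nat) (s : simplex p.+1) (a : 'I_p.+2) :
    simplex p :=
  Simplex (simplex_face_subproof s a).

Lemma simplex_face_face (p : nat) (s : simplex p.+2) (k l : 'I_p.+2) :
  (k <= l)%N -> simplex_face (simplex_face s (lift ord0 l)) k =
                simplex_face (simplex_face s (widen_ord (leqnSn _) k)) l.
Proof.
move=> kl; apply: eq_simplex => i /=; congr (s _); apply: val_inj => /=.
by rewrite /bump; lia.
Qed.

End Simplex.

Section DirectProduct.
Variables (I : Type) (A : I -> zmodType).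

Definition direct_product : Type := forall i, A i.

HB.instance Definition _ := gen_eqMixin direct_product.
HB.instance Definition _ := gen_choiceMixin direct_product.

Implicit Types x y z : direct_product.

Let add x y : direct_product := fun i => x i + y i.
Let opp x : direct_product := fun i => - x i.
Let zero : direct_product := fun=> 0.

Let addA : associative add.
Proof. by move=> x y z; apply: functional_extensionality_dep => i; exact: addrA. Qed.

Let addC : commutative add.
Proof. by move=> x y; apply: functional_extensionality_dep => i; exact: addrC. Qed.

Let add0 : left_id zero add.
Proof. by move=> x; apply: functional_extensionality_dep => i; exact: add0r. Qed.

Let addN : left_inverse zero opp add.
Proof. by move=> x; apply: functional_extensionality_dep => i; exact: addNr. Qed.

HB.instance Definition _ :=
  GRing.isZmodule.Build direct_product addA addC add0 addN.

End DirectProduct.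

Record open_cover (X : topologicalType) (n : nat) := OpenCover {
  cover_set :> 'I_n -> opens X;
  cover_setP : \bigcup_i cover_set i = setT
}.

Section Cech.
Variables (X : topologicalType) (n : nat) (U : open_cover X n).
Variable F : sheaf X.

Lemma cover_inter_subproof (p : nat) (s : simplex n p) :
  open (\bigcap_k (U (s k) : set X)).
Proof.
rewrite openE => x Ux; have : \forall y \near x, forall k, (U (s k) : set X) y.
  by apply: filter_forall => k; apply: open_nbhs_nbhs; split;
    [exact: open_setP|exact: Ux].
by apply: filterS => y Uy k _; exact: Uy.
Qed.

Definition cover_inter (p : nat) (s : simplex n p) : opens X :=
  Opens (cover_inter_subproof s).

(** The index set is finite, so that this product is the direct sum. *)
Definition cech_cochains (p : nat) : zmodType :=
  direct_product (fun s : simplex n p => F (cover_inter s)).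

Lemma cover_inter_face (p : nat) (s : simplex n p.+1) (a : 'I_p.+2) :
  cover_inter s `<=` cover_inter (simplex_face s a).
Proof. by move=> x Ux k _; exact: Ux. Qed.
Arguments cover_inter_face [p] s a.

Definition cech_coboundary_fun (p : nat) (c : cech_cochains p) :
    cech_cochains p.+1 :=
  fun s => \sum_(a < p.+2)
    restr F (cover_inter_face s a) (c (simplex_face s a))
      *~ (-1) ^+ a.

Lemma cech_coboundary_is_zmod_morphism (p : nat) :
  zmod_morphism (@cech_coboundary_fun p).
Proof.
move=> c c'; apply: functional_extensionality_dep => s.
rewrite [RHS]/GRing.add /= /cech_coboundary_fun -sumrB.
by apply: eq_bigr => a _; rewrite -mulrzBl -raddfB.
Qed.

HB.instance Definition _ (p : nat) := GRing.isZmodMorphism.Build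
  (cech_cochains p) (cech_cochains p.+1) (@cech_coboundary_fun p)
  (@cech_coboundary_is_zmod_morphism p).

Definition cech_coboundary (p : nat) :
    {additive cech_cochains p -> cech_cochains p.+1} :=
  @cech_coboundary_fun p.

Lemma cech_coboundaryK (p : nat) (c : cech_cochains p) :
  cech_coboundary p.+1 (cech_coboundary p c) = 0.
Proof.
apply: functional_extensionality_dep => s.
have restrE t t' (tt' : t = t') (W : opens X) (Wt : W `<=` cover_inter t)
    (Wt' : W `<=` cover_inter t') : restr F Wt (c t) = restr F Wt' (c t').
  by subst t'; congr (restr F _ _); exact: Prop_irrelevance.
pose f (k : 'I_p.+3) (l : 'I_p.+2) : F (cover_inter s) :=
  restr F (subset_trans (cover_inter_face s k)
             (cover_inter_face (simplex_face s k) l))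
    (c (simplex_face (simplex_face s k) l)).
rewrite -[RHS](@alternating_sum0 _ _ f) => [|k l kl]; last first.
  by apply: restrE; exact: simplex_face_face.
apply: eq_bigr => k _; congr (_ *~ _); rewrite raddf_sum.
apply: eq_bigr => l _; rewrite raddfMz; congr (_ *~ _).
exact: restr_comp.
Qed.

Definition cech_complex : cochain_complex := CochainComplex cech_coboundaryK.

End Cech.

Record simplicial_complex (V : finType) := SimplicialComplex {
  complex_faces :> {set {set V}};
  complex_sub : forall A B : {set V},
    A \subset B -> B \in complex_faces -> A \in complex_faces;
  complex_set1 : forall v : V, [set v]%SET \in complex_faces
}.

Section SimplicialCochains.
Variables (n : nat) (D : simplicial_complex 'I_n).

Definition is_face (j : nat) : {pred {set 'I_n}} :=
  fun A => (A \in (D : {set {set 'I_n}})) && (#|A| == j.+1).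

Definition face (j : nat) : finType := {A : {set 'I_n} | is_face j A}.

Lemma card_face (j : nat) (A : face j) : #|val A| = j.+1.
Proof. by case/andP: (valP A) => _ /eqP. Qed.

(** [enum_val] enumerates a subset of ['I_n] in increasing order. *)
Definition vertex (j : nat) (A : face j) (a : 'I_j.+1) : 'I_n :=
  enum_val (cast_ord (esym (card_face A)) a).

Lemma face_delete_subproof (j : nat) (A : face j.+1) (a : 'I_j.+2) :
  is_face j (val A :\ vertex A a)%SET.
Proof.
have /andP[AD /eqP cA] := valP A; apply/andP; split.
  exact: complex_sub (subD1set _ _) AD.
by have /eqP := cardsD1 (vertex A a) (val A); rewrite cA enum_valP eqSS eq_sym.
Qed.

Definition face_delete (j : nat) (A : face j.+1) (a : 'I_j.+2) : face j :=
  Sub (_ :\ _)%SET (face_delete_subproof A a).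

Lemma vertex_delete (j : nat) (A : face j.+1) (a : 'I_j.+2) (b : 'I_j.+1) :
  vertex (face_delete A a) b = vertex A (lift a b).
Proof.
have cA := card_face A.
have x0 := vertex A a.
have sA : size (enum (val A)) = j.+2 by rewrite -cardE.
have vE (i : nat) (B : face i) (k : 'I_i.+1) :
    vertex B k = nth x0 (enum (val B)) k by exact: enum_val_nth.
rewrite !vE /=.
have -> : enum (val A :\ vertex A a)%SET = rem (vertex A a) (enum (val A)).
  rewrite rem_filter ?enum_uniq // /enum_mem -filter_predI.
  by apply: eq_filter => x; rewrite /= !inE.
have ia : index (vertex A a) (enum (val A)) = a.
  by rewrite vE index_uniq ?enum_uniq // sA.
rewrite remE ia nth_cat size_take sA ltn_ord; case: ltnP => ba.
  by rewrite nth_take // /bump leqNgt ba.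
by rewrite nth_drop /bump ba; congr nth; lia.
Qed.

Lemma face_delete_delete (j : nat) (A : face j.+2) (k l : 'I_j.+2) :
  (k <= l)%N -> face_delete (face_delete A (lift ord0 l)) k =
                face_delete (face_delete A (widen_ord (leqnSn _) k)) l.
Proof.
move=> kl; apply: val_inj; rewrite /= !vertex_delete.
set w := widen_ord _ k.
have -> : lift (lift ord0 l) k = w.
  by apply: val_inj; rewrite /= /bump; lia.
have -> : lift w l = lift ord0 l.
  by apply: val_inj; rewrite /= /bump; lia.
by apply/setP => x; rewrite !inE andbCA.
Qed.

Variable G : zmodType.

Definition simplicial_cochains (j : nat) : zmodType := {ffun face j -> G}.

Definition simplicial_coboundary_fun (j : nat) (c : simplicial_cochains j) :
    simplicial_cochains j.+1 :=
  [ffun A : face j.+1 =>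
    \sum_(a < j.+2) c (face_delete A a) *~ (-1) ^+ a].

Lemma simplicial_coboundary_is_zmod_morphism (j : nat) :
  zmod_morphism (@simplicial_coboundary_fun j).
Proof.
move=> c c'; apply/ffunP => A; rewrite !ffunE -sumrB.
by apply: eq_bigr => a _; rewrite !ffunE mulrzBl.
Qed.

HB.instance Definition _ (j : nat) := GRing.isZmodMorphism.Build
  (simplicial_cochains j) (simplicial_cochains j.+1)
  (@simplicial_coboundary_fun j) (@simplicial_coboundary_is_zmod_morphism j).

Definition simplicial_coboundary (j : nat) :
    {additive simplicial_cochains j -> simplicial_cochains j.+1} :=
  @simplicial_coboundary_fun j.

Lemma simplicial_coboundaryK (j : nat) (c : simplicial_cochains j) :
  simplicial_coboundary j.+1 (simplicial_coboundary j c) = 0.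
Proof.
apply/ffunP => A; rewrite !ffunE.
rewrite -[RHS](@alternating_sum0 _ _
  (fun k l => c (face_delete (face_delete A k) l))) => [|k l kl].
  by apply: eq_bigr => k _; rewrite ffunE.
by rewrite face_delete_delete.
Qed.

Definition simplicial_cochain_complex : cochain_complex :=
  CochainComplex simplicial_coboundaryK.

End SimplicialCochains.

Section SimplicialBinoid.
Variables (V : finType) (D : simplicial_complex V).

Definition simplicial_relation (a b : free_binoid V) : Prop :=
  exists H : {set V}, [/\ H \notin (D : {set {set V}}),
    a = \sum_(v in H) free_gen v & b = infty].

Definition simplicial_binoid : binoidType :=
  quotient_binoid simplicial_relation.

Definition gen (v : V) : simplicial_binoid :=
  \pi_(quotient_binoid simplicial_relation) (free_gen v).

End SimplicialBinoid.

Section GeneratorCover.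
Variables (n : nat) (D : simplicial_complex 'I_n).
Let M := simplicial_binoid D.

Definition punctured_basic_open (N : binoidType) (f : N) :
    set (punctured_spec N) :=
  [set p : punctured_spec N | ~ prime_set (set_val p) f].

Lemma punctured_basic_openP (N : binoidType) (f : N) :
  open (punctured_basic_open f).
Proof.
exists (basic_open f) => //; exists [set f]; by rewrite bigcup_set1.
Qed.

Definition D_open (N : binoidType) (f : N) : opens (punctured_spec N) :=
  Opens (punctured_basic_openP f).

Lemma prime_ideal_units (N : binoidType) (p : spec N) (a : N) :
  units a -> ~ prime_set p a.
Proof.
by move=> [b ab] pa; apply: (@prime_ideal0 _ p); rewrite -ab addrC;
  case: (prime_setP p) => -[_ pI] _ _; exact: pI.
Qed.

Lemma prime_ideal_gen (p : spec M) :
  (forall i, prime_set p (gen D i)) -> prime_set p = @nonunits M.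
Proof.
have [[pinf pI] _ _] := prime_setP p.
move=> pgen; apply/seteqP; split=> [a pa aU|a aU].
  exact: prime_ideal_units aU pa.
pose q : free_binoid 'I_n := repr (a : quotient_binoid (simplicial_relation D)).
have piD b c : \pi_(quotient_binoid (simplicial_relation D)) (b + c) =
    (\pi_(quotient_binoid (simplicial_relation D)) b : M) +
    (\pi_(quotient_binoid (simplicial_relation D)) c : M).
  by rewrite [RHS]quotient_binoid_addE.
have qE : \pi_(quotient_binoid (simplicial_relation D)) q = a by exact: reprK.
case: q qE => [f|] qE; last by rewrite -qE.
have [f0|[v fv]] : f = 0 \/ exists v, f v != 0%N.
- case: (pickP (fun v => f v != 0%N)) => [v fv|f0]; [by right; exists v|left].
  by apply/ffunP => v; rewrite ffunE; apply/eqP; rewrite -[_ == _]negbK f0.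
- by case: aU; exists 0; rewrite addr0 -qE f0.
pose g : {ffun 'I_n -> nat} := [ffun w => f w - (w == v)]%N.
have fE : Some f = (Some g : free_binoid _) + free_gen v.
  congr Some; apply/ffunP => w; rewrite !ffunE -[RHS]/(_ + _)%N subnK //.
  by have [->|//] := eqVneq w v; rewrite lt0n.
by rewrite -qE fE piD; apply: pI; exact: pgen.
Qed.

Lemma generator_cover_subproof :
  \bigcup_(i : 'I_n) (D_open (gen D i) : set _) = setT.
Proof.
apply/seteqP; split=> // p _; apply: contrapT => np.
have /= := set_valP p; apply; apply: prime_ideal_gen => i.
by apply: contrapT => pi; apply: np; exists i.
Qed.

Definition generator_cover : open_cover (punctured_spec M) n :=
  OpenCover generator_cover_subproof.

End GeneratorCover.

(* Main.v *)
(** For a face [A] of the complex, the ideal [p_A] generated by the [x_v] with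
    [v] outside [A] is prime, and it is the largest prime lying in all [D(x_v)]
    with [v] in [A].  As basic opens are closed under passing to smaller primes,
    every neighbourhood of [p_A] contains the whole intersection of these
    [D(x_v)], so that a locally constant function on it is constant.  If [A] is
    not a face, then the [x_v] with [v] in [A] sum to [infty], and the
    intersection is empty.  Hence the Cech cochains are the functions on the
    faces, and the two coboundaries agree. *)

From HB Require Import structures.
Require Import Defs.
From mathcomp Require Import all_boot all_algebra.
From mathcomp Require Import all_classical topology.

Set Implicit Arguments.
Unset Strict Implicit.
Unset Printing Implicit Defensive.

Import GRing.Theory.
Local Open Scope quotient_scope.
Local Open Scope classical_set_scope.
Local Open Scope ring_scope.

(** * Cohomology of cochain maps that are bijective in each degree *)

Lemma bijective_cohomology_map (C C' : cochain_complex)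
    (phi : cochain_map C C') :
  (forall j, bijective (phi j)) -> forall j, bijective (cohomology_map phi j).
Proof.
move=> phi_bij j; rewrite -setTT_bijective.
(* Coboundaries are reflected: a primitive is pulled back by surjectivity one degree lower, and
   injectivity in the degree of [c] identifies its coboundary. In degree 0 the image is zero and
   injectivity suffices. *)
have image_phi (c : C j) : in_image (phi j c) -> in_image c.
  case: j c => [c|i c [b' bc]] /=.
    by rewrite -[X in _ = X](raddf0 (phi 0)) => /(bij_inj (phi_bij 0)).
  have [psi _ phiK] := phi_bij i; exists (psi b').
  by apply: (bij_inj (phi_bij i.+1)); rewrite cochain_mapE phiK.
split=> // [x y _ _|y _].
  rewrite -[x](@cohomology_class_repr C j) -[y](@cohomology_class_repr C j).
  rewrite !cohomology_mapE => /cohomology_classP xy.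
  by apply/cohomology_classP/image_phi; rewrite raddfB.
rewrite -[y](@cohomology_class_repr C' j); set z := repr _.
have [psi _ phiK] := phi_bij j.
(* The preimage of a cocycle is a cocycle by injectivity one degree higher. *)
have zP : psi (cocycle_val z) \in @is_cocycle C j.
  apply/eqP/(bij_inj (phi_bij j.+1)).
  by rewrite cochain_mapE phiK (eqP (cocycleP z)) raddf0.
exists (cohomology_class (Cocycle zP)) => //.
rewrite cohomology_mapE; congr cohomology_class.
by apply: val_inj; rewrite /= phiK.
Qed.

Lemma const_section_is_zmod_morphism (X : topologicalType) (G : zmodType)
  (U : opens X) : zmod_morphism (@const_section X G U).
Proof. by move=> g h; exact: constant_sectionP. Qed.

HB.instance Definition _ (X : topologicalType) (G : zmodType) (U : opens X) :=
  GRing.isZmodMorphism.Build _ _ (@const_section X G U)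
    (@const_section_is_zmod_morphism X G U).

(** * Increasing index sequences and faces *)

Section SimplexFace.
Variables (n : nat) (D : simplicial_complex 'I_n).

(** The enumeration of [A] is a filtered sublist of that of ['I_n], whose values are 0, 1, ...,
    n-1. *)
Lemma enum_set_ord_sorted (A : {set 'I_n}) : sorted ltn (map val (enum A)).
Proof.
have trans_val : transitive (relpre (val : 'I_n -> nat) ltn).
  by move=> i k l; exact: ltn_trans.
rewrite sorted_map /enum_mem sorted_filter //.
by rewrite -sorted_map -enumT val_enum_ord iota_ltn_sorted.
Qed.

Lemma vertex_ltn (j : nat) (A : face D j) (k l : 'I_j.+1) : (k < l)%N ->
  (vertex A k < vertex A l)%N.
Proof.
(* [v] only serves as the default of [nth]; both positions are within range. *)
move=> kl; have v := vertex A k; rewrite /vertex !(enum_val_nth v) /=.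
have lA : (l < size (enum (val A)))%N by rewrite -cardE card_face.
have kA := ltn_trans kl lA.
rewrite -!(nth_map _ 0%N val) //.
apply: (sorted_ltn_nth ltn_trans 0%N (enum_set_ord_sorted _)) => //;
  by rewrite inE size_map.
Qed.

Definition simplex_of_face (j : nat) (A : face D j) : simplex n j :=
  Simplex (@vertex_ltn j A).

Definition simplex_set (j : nat) (s : simplex n j) : {set 'I_n} :=
  [set s k | k : 'I_j.+1]%SET.

Lemma mem_simplex_set (j : nat) (s : simplex n j) (k : 'I_j.+1) :
  s k \in simplex_set s.
Proof. exact: imset_f. Qed.

Lemma simplex_inj (j : nat) (s : simplex n j) : injective s.
Proof.
move=> k l kl; apply/val_inj/eqP; rewrite eqn_leq; apply/andP.
by split; rewrite leqNgt; apply/negP => /(simplexP s); rewrite kl ltnn.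
Qed.

Lemma card_simplex_set (j : nat) (s : simplex n j) : #|simplex_set s| = j.+1.
Proof. by rewrite card_imset ?card_ord //; exact: simplex_inj. Qed.

(** Two strictly increasing lists with the same members coincide. *)
Lemma simplex_set_inj (j : nat) : injective (@simplex_set j).
Proof.
move=> s t st; apply: eq_simplex => a.
have sortedE (u : simplex n j) :
    sorted (relpre val ltn) [seq u k | k <- enum 'I_j.+1].
  have : sorted ltn (map val (enum 'I_j.+1)).
    by rewrite val_enum_ord iota_ltn_sorted.
  by rewrite !sorted_map; apply: sub_sorted => k l; exact: simplexP.
have memE (u : simplex n j) : [seq u k | k <- enum 'I_j.+1] =i simplex_set u.
  by move=> v; apply/mapP/imsetP => -[k _ ->]; exists k; rewrite // mem_enum.
have : [seq s k | k <- enum 'I_j.+1] = [seq t k | k <- enum 'I_j.+1].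
  apply: (irr_sorted_eq (leT := relpre (val : 'I_n -> nat) ltn)) => //.
  - by move=> k l m; exact: ltn_trans.
  - by move=> k; exact: ltnn.
  - by move=> v; rewrite !memE st.
by move/eq_in_map; apply; rewrite mem_enum.
Qed.

Lemma simplex_set_of_face (j : nat) (A : face D j) :
  simplex_set (simplex_of_face A) = val A.
Proof.
apply/eqP; rewrite eqEcard card_simplex_set card_face leqnn andbT.
by apply/fintype.subsetP => _ /imsetP[k _ ->]; exact: enum_valP.
Qed.

Lemma simplex_face_of_face (j : nat) (A : face D j.+1) (a : 'I_j.+2) :
  simplex_face (simplex_of_face A) a = simplex_of_face (face_delete A a).
Proof. by apply: eq_simplex => b /=; rewrite vertex_delete. Qed.

End SimplexFace.

(** * Prime ideals of the simplicial binoid attached to faces *)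

Section FacePrime.
Variables (V : finType) (D : simplicial_complex V).
Let M := simplicial_binoid D.
Let pi : free_binoid V -> M :=
  fun q => \pi_(quotient_binoid (simplicial_relation D)) q.

Lemma pi_is_nmod_morphism : nmod_morphism pi.
Proof. by split=> // a b; rewrite [RHS]quotient_binoid_addE. Qed.

HB.instance Definition _ :=
  GRing.isNmodMorphism.Build _ _ pi pi_is_nmod_morphism.

Lemma sum_gen_nonface (H : {set V}) :
  H \notin (D : {set {set V}}) -> \sum_(v in H) gen D v = infty.
Proof.
move=> HD; rewrite -[LHS](raddf_sum pi).
by apply/quotient_binoidP/cong_rel; exists H.
Qed.

Lemma some_sum_free_gen (f : {ffun V -> nat}) :
  Some f = \sum_v free_gen v *+ f v :> free_binoid V.
Proof.
pose some : {ffun V -> nat} -> free_binoid V := Some.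
have someD : nmod_morphism some by [].
pose someM := GRing.isNmodMorphism.Build _ _ some someD.
pose F : {additive _ -> _} := HB.pack some someM.
rewrite (eq_bigr (fun v => F ([ffun w => (w == v) : nat] *+ f v))).
  rewrite -raddf_sum; congr Some; apply/ffunP => w.
  rewrite sum_ffunE (bigD1 w) //= big1 ?addr0 => [|v vw].
    by rewrite ffunMnE ffunE eqxx natn.
  by rewrite ffunMnE ffunE eq_sym (negbTE vw) mul0rn.
by move=> v _; rewrite raddfMn.
Qed.

(** Membership in the ideal of the free binoid generated by the [free_gen v] with [v] in [B]; the
    value at [None] is [true] because every ideal contains the absorbing element. *)
Definition support_meets (B : {set V}) (q : free_binoid V) : bool :=
  if q is Some f then [exists v in B, f v != 0%N] else true.

Lemma support_meets0 (B : {set V}) : support_meets B 0 = false.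
Proof. by apply/existsP => -[v]; rewrite ffunE andbF. Qed.

Lemma support_meetsD (B : {set V}) (p q : free_binoid V) :
  support_meets B (p + q) = support_meets B p || support_meets B q.
Proof.
case: p q => [f|] [g|] //=; last by rewrite orbT.
apply/existsP/orP => [[v /andP[vB]]|].
  by rewrite ffunE addn_eq0 negb_and => /orP[fv|gv]; [left|right]; apply/existsP;
    exists v; rewrite vB.
by case=> /existsP[v /andP[vB fv]]; exists v; rewrite vB ffunE addn_eq0 negb_and fv
  ?orbT.
Qed.

Lemma support_meets_gen (B : {set V}) (v : V) :
  support_meets B (free_gen v) = (v \in B).
Proof.
apply/existsP/idP => [[w]|vB]; last by exists v; rewrite vB ffunE eqxx.
by rewrite ffunE eqb0 negbK => /andP[wB /eqP<-].
Qed.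

(** A nonface [H] is not contained in the face [A], so it has a vertex outside [A]; hence both sides
    of each defining relation meet the complement of [A]. Additivity of [support_meets] carries this
    to the generated congruence. *)
Lemma support_meets_congruence (A : {set V}) (p q : free_binoid V) :
  A \in (D : {set {set V}}) -> congruence (simplicial_relation D) p q ->
  support_meets (~: A) p = support_meets (~: A) q.
Proof.
move=> AD; elim=> {p q}//=.
- move=> p q [H [HD -> ->]].
  rewrite (big_morph _ (support_meetsD (~: A)) (support_meets0 _)) big_has_cond.
  apply/hasP; suff /fintype.subsetPn[v vH vA] : ~~ (H \subset A).
    by exists v; rewrite ?mem_index_enum // inE vH support_meets_gen inE.
  by apply: contra HD => HA; exact: complex_sub HA AD.
- by move=> p q r _ -> _ ->.
- by move=> p q r _ pq; rewrite !support_meetsD pq.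
Qed.

(** The ideal of [M] generated by the [x_v] with [v] outside [A]. *)
Definition face_prime_set (A : {set V}) : set M :=
  [set a | support_meets (~: A)
             (repr (a : quotient_binoid (simplicial_relation D)))].

(** Invariance under the congruence makes the choice of representative immaterial. *)
Lemma face_prime_setE (A : {set V}) (q : free_binoid V) :
  A \in (D : {set {set V}}) ->
  face_prime_set A (pi q) = support_meets (~: A) q.
Proof.
move=> AD; rewrite /face_prime_set /=; congr is_true.
by apply: support_meets_congruence AD _; apply/quotient_binoidP; rewrite reprK.
Qed.

Lemma face_prime_subproof (A : {set V}) :
  A \in (D : {set {set V}}) -> prime_ideal (face_prime_set A).
Proof.
move=> AD; have piK (a : M) : exists q, a = pi q.
  exists (repr (a : quotient_binoid (simplicial_relation D))).
  by rewrite /pi reprK.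
split.
- split; first by rewrite -[infty]/(pi None) face_prime_setE.
  move=> a b; have [q ->] := piK a; have [r ->] := piK b.
  by rewrite -raddfD !face_prime_setE // support_meetsD => ->; rewrite orbT.
(* Properness: [0] has empty support, so it stays outside the ideal. *)
- move=> /(congr1 (fun I : set M => I (pi 0))).
  rewrite face_prime_setE // support_meets0 => f0.
  by have : [set: M] (pi 0) by []; rewrite -f0.
- move=> a b; have [q ->] := piK a; have [r ->] := piK b.
  by rewrite -raddfD !face_prime_setE // support_meetsD => /orP.
Qed.

Definition face_prime (A : {set V}) (AD : A \in (D : {set {set V}})) :
  spec M := Spec (face_prime_subproof AD).

Lemma face_prime_gen (A : {set V}) (AD : A \in (D : {set {set V}}))
  (v : V) : prime_set (face_prime AD) (gen D v) = (v \notin A).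
Proof. by rewrite /= [LHS]face_prime_setE // support_meets_gen inE. Qed.

(** An element outside [face_prime AD] is a sum of generators [gen D v] with [v] in [A]. These avoid
    [p], and the complement of a prime contains [0] and is closed under addition. *)
Lemma face_prime_max (A : {set V}) (AD : A \in (D : {set {set V}}))
    (p : spec M) :
  (forall v, v \in A -> ~ prime_set p (gen D v)) -> p `<=` face_prime AD.
Proof.
move=> pA a; pose q := repr (a : quotient_binoid (simplicial_relation D)).
have <- : pi q = a by exact: reprK.
rewrite /= face_prime_setE //; apply: contraPT => qA.
case: q qA => [f|] //=; rewrite negb_exists => /forallP fA.
rewrite some_sum_free_gen raddf_sum.
apply: (big_ind (fun b : M => ~ prime_set p b)) => [|b c|v _].
- exact: prime_ideal0.
- exact: prime_ideal_add.
rewrite raddfMn; have := fA v; rewrite inE negb_and negbK orbC negbK.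
case/orP=> [/eqP->|/pA pv]; first exact: prime_ideal0.
elim: (f v) => [|m IH]; first exact: prime_ideal0.
by rewrite mulrS; exact: prime_ideal_add.
Qed.

(** The prime of the empty face contains every generator, and a prime contains no unit. *)
Lemma gen_nonunit (v : V) : ~ units (gen D v).
Proof.
have D0 : finset.set0 \in (D : {set {set V}}).
  exact: complex_sub (finset.sub0set _) (complex_set1 D v).
by move=> /(prime_ideal_units (p := face_prime D0)); rewrite face_prime_gen inE.
Qed.

(** For [v] in [A], the nonunit [gen D v] lies outside this prime, which therefore differs from the
    maximal ideal. *)
Lemma face_prime_punctured (A : {set V}) (AD : A \in (D : {set {set V}}))
  (v : V) : v \in A -> @punctured M (face_prime AD).
Proof.
move=> vA /(congr1 (fun I : set M => I (gen D v))).
rewrite face_prime_gen vA /= => pv.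
by have := @gen_nonunit v; rewrite -[~ _]/(nonunits (gen D v)) -pv.
Qed.

End FacePrime.

(** * Comparison of simplicial and Čech cochains *)

Section Comparison.
Variables (n : nat) (D : simplicial_complex 'I_n) (G : zmodType).
Let M := simplicial_binoid D.
Let X := punctured_spec M.
Let U (j : nat) (s : simplex n j) : opens X :=
  cover_inter (generator_cover D) s.

Lemma cover_inter_nonface (j : nat) (s : simplex n j) :
  simplex_set s \notin (D : {set {set 'I_n}}) -> forall p, ~ (U s : set X) p.
Proof.
move=> /sum_gen_nonface sD p Up.
have [[pinf _] _ _] := prime_setP (set_val p); move: pinf; rewrite -sD.
apply: (big_ind (fun a : M => ~ prime_set (set_val p) a)).
- exact: prime_ideal0.
- exact: prime_ideal_add.
- by move=> _ /imsetP[k _ ->]; exact: Up.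
Qed.

Lemma section_nonface (j : nat) (s : simplex n j) :
  simplex_set s \notin (D : {set {set 'I_n}}) ->
  forall f g : constant_sheaf X G (U s), f = g.
Proof.
move=> sD f g; apply: constant_sectionP => x.
by case: (cover_inter_nonface sD (set_valP x)).
Qed.

Section FacePoint.
Variables (j : nat) (s : simplex n j).
Hypothesis sD : simplex_set s \in (D : {set {set 'I_n}}).

(** The vertex [s ord0] shows that the face is nonempty, which places its prime in the punctured
    spectrum. *)
Definition face_point : X := exist _ (face_prime sD)
  (mem_set (face_prime_punctured (AD := sD) (mem_simplex_set s ord0))).

Lemma face_point_subproof : (U s : set X) face_point.
Proof.
move=> k _.
rewrite -[_ face_point]/(~ prime_set (face_prime sD) (gen D (s k))).
by rewrite face_prime_gen mem_simplex_set.
Qed.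

Definition cover_face_point : U s :=
  exist _ face_point (mem_set face_point_subproof).

Lemma section_face (f : constant_section G (U s)) (x : U s) :
  f x = f cover_face_point.
Proof.
have /asboolP/(_ cover_face_point) := section_funP f.
(* A neighbourhood is unfolded through two subspace topologies to a union of basic opens, one of
   which, that of [g], contains the face prime. Since [x] is contained in the face prime, it avoids
   [g] too. *)
move=> [_ [[_ [_ [F ->] <-] <-] [g Fg pg] fE]]; apply: fE.
exists g => // /= xg; apply: pg; apply: face_prime_max xg => v /imsetP[k _ ->].
exact: (set_valP x).
Qed.

End FacePoint.

(** The value 0 on nonfaces is forced, as the group of sections over the empty set is trivial. *)
Definition comparison_fun (j : nat) (c : simplicial_cochains D G j) :
    cech_cochains (generator_cover D) (constant_sheaf X G) j :=
  fun s => if (insub (simplex_set s) : option (face D j)) is Some A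
           then const_section (U s) (c A) else 0.

Lemma comparison_is_zmod_morphism (j : nat) : zmod_morphism (@comparison_fun j).
Proof.
move=> c c'; apply: functional_extensionality_dep => s.
rewrite -[RHS]/(comparison_fun c s - comparison_fun c' s) /comparison_fun.
case: insub => [A|]; last by rewrite subr0.
by rewrite !ffunE raddfB.
Qed.

HB.instance Definition _ (j : nat) := GRing.isZmodMorphism.Build _ _
  (@comparison_fun j) (@comparison_is_zmod_morphism j).

Lemma comparison_face (j : nat) (c : simplicial_cochains D G j)
  (A : face D j) (s : simplex n j) : val A = simplex_set s ->
  comparison_fun c s = const_section (U s) (c A).
Proof. by move=> As; rewrite /comparison_fun -As valK. Qed.

Variant simplex_face_spec (j : nat) (s : simplex n j) : Prop :=
| SimplexFace (A : face D j) of s = simplex_of_face A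
| SimplexNonface of simplex_set s \notin (D : {set {set 'I_n}}).

Lemma simplex_faceP (j : nat) (s : simplex n j) : simplex_face_spec s.
Proof.
have [sD|] := boolP (simplex_set s \in (D : {set {set 'I_n}})); last by right.
have sF : is_face D j (simplex_set s).
  by rewrite /is_face sD card_simplex_set eqxx.
left with (Sub (simplex_set s) sF : face D j).
by apply: simplex_set_inj; rewrite simplex_set_of_face.
Qed.

Lemma comparisonE (j : nat) (c : simplicial_cochains D G j) :
  comparison_fun (simplicial_coboundary D G j c) =
  cech_coboundary (generator_cover D) (constant_sheaf X G) j (comparison_fun c).
Proof.
apply: functional_extensionality_dep => s.
have [A ->|sD] := simplex_faceP s; last exact: section_nonface.
rewrite (comparison_face _ (esym (simplex_set_of_face A))) ffunE raddf_sum.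
apply: eq_bigr => a _; rewrite raddfMz; congr (_ *~ _).
(* Omitting the [a]-th index corresponds to deleting the [a]-th vertex, so the terms match with
   their signs; a constant section restricts to a constant section. *)
rewrite (@comparison_face _ c (face_delete A a)); last first.
  by rewrite simplex_face_of_face simplex_set_of_face.
exact: constant_sectionP.
Qed.

Definition comparison : cochain_map (simplicial_cochain_complex D G)
    (cech_complex (generator_cover D) (constant_sheaf X G)) :=
  @CochainMap (simplicial_cochain_complex D G)
    (cech_complex (generator_cover D) (constant_sheaf X G))
    (fun j => @comparison_fun j) comparisonE.

Lemma simplex_of_face_in (j : nat) (A : face D j) :
  simplex_set (simplex_of_face A) \in (D : {set {set 'I_n}}).
Proof. by rewrite simplex_set_of_face; case/andP: (valP A). Qed.

Lemma comparison_bijective (j : nat) : bijective (@comparison_fun j).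
Proof.
(* The inverse evaluates each section at the prime of the face, which determines the section by
   [section_face]. *)
exists (fun d => [ffun A => (d (simplex_of_face A) : constant_section G _)
  (cover_face_point (simplex_of_face_in A))]).
  move=> c; apply/ffunP => A; rewrite ffunE.
  by rewrite (comparison_face _ (esym (simplex_set_of_face A))).
move=> d; apply: functional_extensionality_dep => s.
have [A ->|sD] := simplex_faceP s; last exact: section_nonface.
rewrite (comparison_face _ (esym (simplex_set_of_face A))).
apply: constant_sectionP => x.
by rewrite [RHS](section_face (simplex_of_face_in A)) /= ffunE.
Qed.

End Comparison.

(** The second clause expresses that the identification is canonical: it fixes [Phi] on simplices
    spanning a face, and over the other simplices the sections form a trivial group. *)
Theorem theorem2p10 (n : nat) (D : simplicial_complex 'I_n) (G : zmodType) :
  exists Phi : cochain_map (simplicial_cochain_complex D G)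
      (cech_complex (generator_cover D)
         (constant_sheaf (punctured_spec (simplicial_binoid D)) G)),
    [/\ forall j : nat, bijective (Phi j),
        (forall (j : nat) (c : {ffun face D j -> G}) (A : face D j)
           (s : simplex n j),
           val A = [set s k | k : 'I_j.+1]%SET ->
           (Phi j c : forall s : simplex n j,
              constant_sheaf (punctured_spec (simplicial_binoid D)) G
                (cover_inter (generator_cover D) s)) s =
           const_section (cover_inter (generator_cover D) s) (c A))
      & forall i : nat, bijective (cohomology_map Phi i)].
Proof.
exists (comparison D G); split.
- exact: comparison_bijective.
- by move=> j c A s; exact: comparison_face.
- by apply: bijective_cohomology_map; exact: comparison_bijective.
Qed.
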